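(* In the SLAR setting, let $w^*=(w_1^*,\dots,w_d^* )$ be a minimizer of the optimal adversarial training objective $$\mathbb E_{(x,y)\sim\mathcal D}\big[\max(0,1-yw^\top x+\varepsilon\|w\|_1)\big]+\frac{\lambda}{2}\|w\|_2^2$$ (equivalently of $U(\delta_w,w)$ with $\delta_w(x,y)=-y\varepsilon\operatorname{sign}(w)$). Then for every non-robust feature $x_i$, $w_i^*=0$.
   Context: SLAR setting: $(x,y)$ is drawn from a distribution $\mathcal D$ on $\mathbb R^d\times\{-1,+1\}$, $x=(x_1,\dots,x_d)$ with finite second moments, such that (A1) for each $i$ there is a constant $\mu_i$ with $\mathbb E[x_i\mid y]=y\mu_i$ for $y\in\{-1,1\}$, and (A2) the coordinates $x_1,\dots,x_d$ are mutually independent conditionally on $y$. Fix $\lambda>0$ and a perturbation budget $\varepsilon>0$. For a perturbation function $\delta$ (map with $\|\delta(x,y)\|_\infty\le\varepsilon$) and $w\in\mathbb R^d$ let $U(\delta,w)=\mathbb E_{(x,y)\sim\mathcal D}[\max(0,1-yw^\top(x+\delta(x,y)))]+\frac{\lambda}{2}\|w\|_2^2$. A feature $x_i$ is non-robust if $|\mu_i|\le\varepsilon$, and robust otherwise. $\operatorname{sign}$ is coordinatewise with $\operatorname{sign}(0)=0$. *)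

(* Defs.v *)
From HB Require Import structures.
From mathcomp Require Import all_boot all_order all_algebra.
From mathcomp Require Import all_classical all_reals all_analysis.
Set Implicit Arguments. Unset Strict Implicit. Unset Printing Implicit Defensive.
Import Order.TTheory GRing.Theory Num.Theory.
Import numFieldNormedType.Exports.
Local Open Scope classical_set_scope.
Local Open Scope ring_scope.

(* The data (x,y) ~ D is modelled by random variables on a probability space
   (T, P): x_i = X i, y = Y. *)

Definition label_pm1 (R : realType) (dT : measure_display) (T : measurableType dT)
  (Y : T -> R) : Prop := forall t, Y t = 1 \/ Y t = -1.

Definition slar_moments (R : realType) (d : nat) (dT : measure_display)
  (T : measurableType dT) (P : probability T R) (X : 'I_d -> T -> R) (Y : T -> R) : Prop :=
  measurable_fun setT Y /\
  forall i, measurable_fun setT (X i) /\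
            P.-integrable setT (fun t => ((X i t) ^+ 2)%:E).

(* (A1): E[x_i | y] = y mu_i for y in {-1,1}, written in the elementary form
   E[x_i 1_{y = s}] = s mu_i P(y = s)   (s = -1, 1). *)
Definition slar_A1 (R : realType) (d : nat) (dT : measure_display)
  (T : measurableType dT) (P : probability T R) (X : 'I_d -> T -> R) (Y : T -> R)
  (mu : 'I_d -> R) : Prop :=
  forall (i : 'I_d) (s : R), (s = 1 \/ s = -1) ->
    (\int[P]_(t in [set t | Y t = s]) (X i t)%:E
      = (s * mu i)%:E * P [set t | Y t = s])%E.

(* (A2): x_1, ..., x_d mutually independent conditionally on y:
   P(y=s)^d * P(y = s, x_i in B_i for all i) = P(y=s) * prod_i P(y = s, x_i in B_i)
   for all Borel sets B_i (i.e. P(all | y=s) = prod_i P(x_i in B_i | y=s)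
   whenever P(y=s) > 0; taking B_j = R for j outside a subfamily gives
   independence of every subfamily). *)
Definition slar_A2 (R : realType) (d : nat) (dT : measure_display)
  (T : measurableType dT) (P : probability T R) (X : 'I_d -> T -> R) (Y : T -> R) : Prop :=
  forall (s : R) (B : 'I_d -> set R), (s = 1 \/ s = -1) ->
    (forall i, measurable (B i)) ->
    fine (P [set t | Y t = s]) ^+ d
      * fine (P [set t | Y t = s /\ forall i, B i (X i t)])
    = fine (P [set t | Y t = s])
      * \prod_(i < d) fine (P [set t | Y t = s /\ B i (X i t)]).

Definition adv_obj (R : realType) (d : nat) (dT : measure_display)
  (T : measurableType dT) (P : probability T R) (X : 'I_d -> T -> R) (Y : T -> R)
  (lam eps : R) (w : 'I_d -> R) : \bar R :=
  (\int[P]_t (Num.max 0 (1 - Y t * (\sum_(i < d) w i * X i t)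
                           + eps * \sum_(i < d) `|w i|))%:E
   + (lam / 2 * \sum_(i < d) w i ^+ 2)%:E)%E.

Definition non_robust (R : realType) (eps mui : R) : Prop := `|mui| <= eps.

(* Main.v *)
Require Import Defs.
From HB Require Import structures.
From mathcomp Require Import all_boot all_order all_algebra.
From mathcomp Require Import all_classical all_reals all_analysis.
From mathcomp Require Import measurable_realfun ring lra.
Import Order.TTheory GRing.Theory Num.Theory.
Local Open Scope classical_set_scope.
Local Open Scope ring_scope.

(** Compare [wstar] with the vector [v] obtained from it by zeroing the [i]-th
    weight, and write the margin of [wstar] as [A + b], where [A] is the margin
    of [v] and [b = eps |wstar_i| - y wstar_i x_i].  By convexity of the hinge,
    [max 0 (A + b) >= max 0 A + 1_{A > 0} b].  Given [y = s] the event [A > 0]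
    depends on the features other than [x_i] only, hence is independent of
    [x_i], so [E[1_{A > 0} b | y = s] = P(A > 0 | y = s) (eps |wstar_i| -
    wstar_i mu_i) >= 0] for a non-robust feature.  Thus zeroing [wstar_i] does
    not increase the hinge term and decreases the regularizer by
    [lam / 2 * wstar_i ^ 2], which minimality forces to vanish. *)

(** * Integrals and independence on a probability space *)

Lemma integral_mrestr (dT : measure_display) (T : measurableType dT)
  (R : realType) (m : {measure set T -> \bar R}) (D : set T)
  (mD : measurable D) (f : T -> \bar R) : measurable_fun setT f ->
  (\int[mrestr m mD]_x f x = \int[m]_(x in D) f x)%E.
Proof.
move=> mf; rewrite -(setUv D) integral_setU //; last 3 first.
- exact: measurableC.
- by rewrite setUv.
- exact/disj_setPCl.
rewrite [X in (_ + X)%E]null_set_integral ?adde0; last 3 first.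
- exact: measurableC.
- exact: measurable_funTS.
- by rewrite /= /mrestr setICl measure0.
by apply: eq_measure_integral => A mA AD; rewrite /= /mrestr setIidl.
Qed.

(** The hypothesis says that two finite measures on the line coincide, namely the laws of [X] on [E]
    and on [D], weighted by [P D] and [P E]; hence they integrate the identity alike. The product
    form avoids dividing by [P D]. *)
Lemma proportional_distribution_integral (dT : measure_display)
  (T : measurableType dT) (R : realType) (P : probability T R)
  (D E : set T) (X : T -> R) :
  measurable D -> measurable E -> measurable_fun setT X ->
  P.-integrable setT (EFin \o X) ->
  (forall B, measurable B ->
     P D * P (E `&` X @^-1` B) = P E * P (D `&` X @^-1` B))%E ->
  (P D * \int[P]_(t in E) (X t)%:E = P E * \int[P]_(t in D) (X t)%:E)%E.
Proof.
move=> mD mE mX iX PDE.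
have finP A : measurable A -> P A = (fine (P A))%:E.
  by move=> mA; rewrite fineK// fin_num_measure.
have fineP0 A : 0 <= fine (P A) by rewrite fine_ge0.
have restr (A C : set T) (mA : measurable A) (f : R -> \bar R) :
    measurable_fun setT f -> (forall x, 0 <= f x)%E -> measurable C ->
    (P C * \int[P]_(t in A) f (X t) =
     \int[mscale (NngNum (fineP0 C)) (pushforward (mrestr P mA) X)]_x f x)%E.
  move=> mf f0 mC; rewrite ge0_integral_mscale//= -finP//.
  rewrite ge0_integral_pushforward// ?preimage_setT ?integral_mrestr//.
  exact: measurableT_comp.
have eq_ge0 (f : R -> \bar R) : measurable_fun setT f ->
    (forall x, 0 <= f x)%E ->
    (P D * \int[P]_(t in E) f (X t) = P E * \int[P]_(t in D) f (X t))%E.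
  move=> mf f0; rewrite !restr//; apply: eq_measure_integral => B mB _.
  by rewrite /= /mscale/= /pushforward /mrestr -!finP// ![_ `&` E]setIC
    ![_ `&` D]setIC PDE.
have iXA A : measurable A -> P.-integrable A (EFin \o X).
  by move=> mA; exact: integrableS iX.
have mEFin : measurable_fun setT (@EFin R) by exact/measurable_EFinP.
have e_pos := eq_ge0 _ (measurable_funepos mEFin) (funepos_ge0 _).
have e_neg := eq_ge0 _ (measurable_funeneg mEFin) (funeneg_ge0 _).
(* The identity changes sign, so its positive and negative parts are treated separately;
   integrability makes their difference well defined. *)
have splitPN A C : measurable A -> measurable C ->
    (P C * \int[P]_(t in A) (X t)%:E =
     P C * \int[P]_(t in A) (@EFin R)^\+ (X t) -
     P C * \int[P]_(t in A) (@EFin R)^\- (X t))%E.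
  move=> mA mC; rewrite integralE muleBr ?fin_num_measure//.
    by congr (_ * _ - _ * _)%E; apply: eq_integral => t _;
      rewrite ?funeposE ?funenegE.
  exact: (integrable_add_def mA (iXA _ mA)).
by rewrite !splitPN// e_pos e_neg.
Qed.

(** As functions of [C], both sides are finite measures. Agreeing on the pi-system [G], which
    contains the whole space, they agree on the sigma-algebra it generates. *)
Lemma cond_indep_g_sigma_algebra (dT : measure_display)
  (T : measurableType dT) (R : realType) (P : probability T R)
  (G : set (set T)) (D F : set T) :
  G `<=` measurable -> setI_closed G -> G setT ->
  measurable D -> measurable F ->
  (forall C, G C -> P D * P (D `&` C `&` F) = P (D `&` C) * P (D `&` F))%E ->
  forall C, <<s G >> C ->
    (P D * P (D `&` C `&` F) = P (D `&` C) * P (D `&` F))%E.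
Proof.
move=> Gm GI GT mD mF indep C GC.
have mDF : measurable (D `&` F) by exact: measurableI.
have finP A : measurable A -> P A = (fine (P A))%:E.
  by move=> mA; rewrite fineK// fin_num_measure.
have fineP0 A : 0 <= fine (P A) by rewrite fine_ge0.
pose m1 := mscale (NngNum (fineP0 D)) (mrestr P mDF).
pose m2 := mscale (NngNum (fineP0 (D `&` F))) (mrestr P mD).
have m1E A : m1 A = (P D * P (D `&` A `&` F))%E.
  by rewrite /m1/= /mscale/= /mrestr -finP// setICA setIA.
have m2E A : m2 A = (P (D `&` A) * P (D `&` F))%E.
  by rewrite /m2/= /mscale/= /mrestr -finP// [A `&` D]setIC muleC.
rewrite -m1E -m2E.
apply: (g_sigma_algebra_measure_unique G Gm (fun=> setT)) => //.
- by rewrite bigcup_const//; exists 0%N.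
- by move=> A GA; have := indep A GA; rewrite -m1E -m2E.
- move=> _; rewrite -[X in (X < _)%E]/(m1 setT) m1E ltey_eq fin_numM// fin_num_measure//.
  by rewrite setIT.
Qed.

(** Domination by [1 + f ^ 2], the constant being integrable for a probability. *)
Lemma integrable_of_sqr (dT : measure_display) (T : measurableType dT)
  (R : realType) (P : probability T R) (f : T -> R) :
  measurable_fun setT f -> P.-integrable setT (fun t => (f t ^+ 2)%:E) ->
  P.-integrable setT (EFin \o f).
Proof.
move=> mf if2.
have i1 : P.-integrable setT (EFin \o cst (1 : R)).
  exact: finite_measure_integrable_cst.
apply: le_integrable (integrableD measurableT i1 if2) => //.
- exact/measurable_EFinP.
- move=> t _ /=; rewrite lee_fin [leRHS]ger0_norm ?addr_ge0 ?sqr_ge0//.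
  by case: (ger0P (f t)) => ft; nra.
Qed.

(** * Conditional independence of one feature from the others *)

(* A pi-system generating the sigma-algebra of the features other than [i]. *)
Definition boxes_off {R : realType} {d : nat} {T : Type} (X : 'I_d -> T -> R)
    (i : 'I_d) : set (set T) :=
  [set [set t | forall j, j != i -> B j (X j t)] |
     B in [set B : 'I_d -> set R | forall j, measurable (B j)]].

Lemma boxes_off_setI (R : realType) (d : nat) (T : Type) (X : 'I_d -> T -> R)
  (i : 'I_d) : setI_closed (boxes_off X i).
Proof.
move=> _ _ [B mB <-] [C mC <-]; exists (fun j => B j `&` C j) => /=.
  by move=> j; exact: measurableI.
apply/seteqP; split=> t /=.
- by move=> H; split=> j /H [].
- by move=> [HB HC] j ji; split; [exact: HB|exact: HC].
Qed.

Lemma boxes_off_setT (R : realType) (d : nat) (T : Type) (X : 'I_d -> T -> R)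
  (i : 'I_d) : boxes_off X i setT.
Proof. by exists (fun=> setT) => //; apply/seteqP; split. Qed.

Lemma boxes_off_measurable (R : realType) (d : nat) (dT : measure_display)
  (T : measurableType dT) (X : 'I_d -> T -> R) (i : 'I_d) :
  (forall j, measurable_fun setT (X j)) -> boxes_off X i `<=` measurable.
Proof.
move=> mX _ [B mB <-].
rewrite (_ : [set _ | _] = \bigcap_(j in [set j | j != i]) X j @^-1` B j)//.
apply: fin_bigcap_measurable => [|j _]; first exact: finite_finset.
by rewrite -[_ @^-1` _]setTI; exact: mX.
Qed.

(** (A2) is applied to two boxes with the same sides off [i], the [i]-th side being [B] or the whole
    line. Eliminating the common product [q] over the other features gives the independence. *)
Lemma slar_A2_boxes_off (R : realType) (d : nat) (dT : measure_display)
  (T : measurableType dT) (P : probability T R) (X : 'I_d -> T -> R)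
  (Y : T -> R) (i : 'I_d) (s : R) (B : set R) (C : set T) :
  measurable_fun setT Y -> (forall j, measurable_fun setT (X j)) ->
  slar_A2 P X Y -> s = 1 \/ s = -1 -> measurable B -> boxes_off X i C ->
  let D := Y @^-1` [set s] in
  (P D * P (D `&` C `&` X i @^-1` B) = P (D `&` C) * P (D `&` X i @^-1` B))%E.
Proof.
move=> mY mX A2 s1 mB GC D.
have mD : measurable D by rewrite -[D]setTI; exact: mY.
have mF : measurable (X i @^-1` B) by rewrite -[_ @^-1` _]setTI; exact: mX.
have mC : measurable C by exact: boxes_off_measurable GC.
have mDC : measurable (D `&` C) by exact: measurableI.
have mDF : measurable (D `&` X i @^-1` B) by exact: measurableI.
have mDCF : measurable (D `&` C `&` X i @^-1` B) by exact: measurableI.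
(* A label of probability zero is set apart, since the last step cancels a power of [P D]. *)
have [PD0|PD0] := eqVneq (P D) 0%E.
  rewrite PD0 mul0e (subset_measure0 mDC mD (@subIsetl _ _ _) PD0).
  by rewrite mul0e.
have finP A : measurable A -> P A = (fine (P A))%:E.
  by move=> mA; rewrite fineK// fin_num_measure.
rewrite (finP D)// (finP _ mDC) (finP _ mDF) (finP _ mDCF) -!EFinM.
congr EFin.
case: GC => B' mB' CE.
pose BB (E : set R) j := if j == i then E else B' j.
have mBB E : measurable E -> forall j, measurable (BB E j).
  by move=> mE j; rewrite /BB; case: ifP.
have setBB (E : set R) : [set t | Y t = s /\ forall j, BB E j (X j t)] =
    D `&` C `&` X i @^-1` E.
  rewrite -CE; apply/seteqP; split=> t /=.
    move=> [Yt H]; split; [split=> // j /negPf ji|].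
      by have := H j; rewrite /BB ji.
    by have := H i; rewrite /BB eqxx.
  move=> [[Yt H] Ht]; split=> // j; rewrite /BB.
  by have [->//|/H] := eqVneq j i.
have setDE (E : set R) : [set t | Y t = s /\ E (X i t)] = D `&` X i @^-1` E.
  by [].
pose q := \prod_(j < d | j != i) fine (P [set t | Y t = s /\ B' j (X j t)]).
have prodBB (E : set R) :
    \prod_(j < d) fine (P [set t | Y t = s /\ BB E j (X j t)]) =
    fine (P (D `&` X i @^-1` E)) * q.
  rewrite (bigD1 i)//= /BB eqxx setDE; congr (_ * _).
  by apply: eq_bigr => j /negPf ->.
have := A2 s _ s1 (mBB B mB); rewrite setBB prodBB => h1.
have := A2 s _ s1 (mBB setT measurableT).
rewrite setBB prodBB preimage_setT !setIT => h2.
rewrite -[[set t | _]]/D in h1 h2.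
have p0 : fine (P D) ^+ d != 0.
  by rewrite expf_neq0//; apply: contra PD0 => /eqP p0; rewrite (finP D)// p0.
apply: (mulfI p0); rewrite mulrCA h1 [RHS]mulrA h2; ring.
Qed.

(** As [v i = 0], the sum does not involve [X i] and is a measurable function of the other
    features. *)
Lemma halfspace_boxes_off (R : realType) (d : nat) (dT : measure_display)
  (T : measurableType dT) (X : 'I_d -> T -> R) (i : 'I_d) (v : 'I_d -> R)
  (s c : R) : v i = 0 ->
  <<s boxes_off X i >> [set t | 0 < c - s * \sum_(j < d) v j * X j t].
Proof.
(* [T'] is [T] with the smaller sigma-algebra, so that the usual closure rules for measurable
   functions apply to it. *)
move=> vi0; pose T' : measurableType _ := g_sigma_algebraType (boxes_off X i).
have mX j : j != i -> measurable_fun setT (X j : T' -> R).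
  move=> ji _ B mB; rewrite setTI; apply: sub_sigma_algebra.
  exists (fun k => if k == j then B else setT) => /=.
    by move=> k; case: ifP.
  apply/seteqP; split=> t /=.
    by move=> /(_ j ji); rewrite eqxx.
  by move=> Bt k ki; case: eqVneq => // ->.
have mvX j : measurable_fun setT ((fun t => v j * X j t) : T' -> R).
  have [->|ji] := eqVneq j i.
    by rewrite vi0; under eq_fun do rewrite mul0r; exact: measurable_cst.
  by apply: measurable_funM => //; exact: mX.
have mf : measurable_fun setT
    ((fun t => c - s * \sum_(j < d) v j * X j t) : T' -> R).
  apply: measurable_funB => //; apply: measurable_funM => //.
  exact: measurable_sum.
have := mf measurableT `]0, +oo[%classic (measurable_itv _).
rewrite setTI; congr (<<s _ >> _).
by apply/seteqP; split=> t /=; rewrite in_itv/= andbT.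
Qed.

(** With [E] the domain of integration, independence and (A1) evaluate the integral as
    [P E * (eps * |a| - a * mu i)]. The half-space will be the event that the margin of [v] is
    positive, given the label [s]. *)
Lemma slar_nonrobust_integral_ge0 (R : realType) (d : nat)
  (dT : measure_display) (T : measurableType dT) (P : probability T R)
  (X : 'I_d -> T -> R) (Y : T -> R) (mu : 'I_d -> R) (eps : R)
  (i : 'I_d) (v : 'I_d -> R) (a c s : R) :
  slar_moments P X Y -> slar_A1 P X Y mu -> slar_A2 P X Y ->
  non_robust eps (mu i) -> v i = 0 -> s = 1 \/ s = -1 ->
  (0 <= \int[P]_(t in Y @^-1` [set s] `&`
                      [set t | (0 < c - s * \sum_(j < d) v j * X j t)%R])
          (eps * `|a| - s * (a * X i t))%:E)%E.
Proof.
move=> [mY mX'] A1 A2 nr vi0 s1.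
have mX j : measurable_fun setT (X j) by have [] := mX' j.
have iX : P.-integrable setT (EFin \o X i).
  by have [? ?] := mX' i; exact: integrable_of_sqr.
set D := Y @^-1` _; set C := [set t | _]; set E := D `&` C.
have GC : <<s boxes_off X i >> C by exact: halfspace_boxes_off.
have Gm := boxes_off_measurable _ _ _ _ _ i mX.
have mD : measurable D by rewrite -[D]setTI; exact: mY.
have mC : measurable C.
  exact: (smallest_sub (@sigma_algebra_measurable _ T) Gm).
have mE : measurable E by exact: measurableI.
have iXE : P.-integrable E (EFin \o X i) by exact: integrableS iX.
have [PD0|PD0] := eqVneq (P D) 0%E.
  rewrite null_set_integral//.
    apply/measurable_EFinP; apply: measurable_funTS.
    by apply: measurable_funB => //; do 2 apply: measurable_funM => //.
  exact: (subset_measure0 mE mD (@subIsetl _ _ _) PD0).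
have finP A : measurable A -> P A = (fine (P A))%:E.
  by move=> mA; rewrite fineK// fin_num_measure.
have indep : (P D * \int[P]_(t in E) (X i t)%:E =
              P E * \int[P]_(t in D) (X i t)%:E)%E.
  apply: proportional_distribution_integral => // B mB.
  apply: cond_indep_g_sigma_algebra GC => //.
  - exact: boxes_off_setI.
  - exact: boxes_off_setT.
  - by rewrite -[_ @^-1` _]setTI; exact: mX.
  - by move=> K GK; exact: slar_A2_boxes_off.
have A1s := A1 i s s1; rewrite -[[set t | _]]/D in A1s.
have finX : (\int[P]_(t in E) (X i t)%:E =
             (fine (\int[P]_(t in E) (X i t)%:E))%:E)%E.
  by rewrite fineK//; exact: integrable_fin_num.
move: indep; rewrite A1s finX; set x := fine (integral _ _ _).
rewrite (finP D)// (finP E)// -!EFinM => -[].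
have p0 : fine (P D) != 0.
  by apply: contra PD0 => /eqP p0; rewrite (finP D)// p0.
(* Cancelling [P D] leaves [x = fine (P E) * (s * mu i)]: restricting to the half-space does not
   alter the conditional mean of the feature. *)
rewrite [in RHS]mulrA [in RHS]mulrC => /(mulfI p0) xE.
under eq_integral do rewrite EFinB mulrA [(s * a * _)%:E]EFinM.
have icst : P.-integrable E (EFin \o cst (eps * `|a|)).
  exact: finite_measure_integrable_cst.
have icstE : (\int[P]_(_ in E) (eps * `|a|)%:E)%E = (eps * `|a| * fine (P E))%:E.
  by rewrite integral_cst// [RHS]EFinM -finP.
rewrite integralB//; last exact: integrableZl.
rewrite integralZl// finX -/x icstE -!EFinM -EFinB lee_fin.
rewrite xE.
rewrite (_ : _ - _ = fine (P E) * (eps * `|a| - s ^+ 2 * (a * mu i))); last ring.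
rewrite (_ : s ^+ 2 = 1); last by case: s1 => ->; rewrite ?sqrrN expr1n.
rewrite mul1r mulr_ge0 ?fine_ge0// subr_ge0.
(* Non-robustness enters here: [a * mu i <= |a| * |mu i| <= eps * |a|]. *)
by rewrite (le_trans (ler_norm _))// normrM mulrC ler_wpM2r.
Qed.

(** * Zeroing a non-robust weight of the minimizer *)

Theorem mainTheorem16 (R : realType) (d : nat) (dT : measure_display)
  (T : measurableType dT) (P : probability T R)
  (X : 'I_d -> T -> R) (Y : T -> R) (mu : 'I_d -> R) (lam eps : R)
  (wstar : 'I_d -> R) :
  label_pm1 Y ->
  slar_moments P X Y ->
  slar_A1 P X Y mu ->
  slar_A2 P X Y ->
  0 < lam -> 0 < eps ->
  (forall w : 'I_d -> R, (adv_obj P X Y lam eps wstar <= adv_obj P X Y lam eps w)%E) ->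
  forall i : 'I_d, non_robust eps (mu i) -> wstar i = 0.
Proof.
move=> Ypm1 mom A1 A2 lam0 eps0 wmin i nr.
have [mY mX'] := mom.
have mX j : measurable_fun setT (X j) by have [] := mX' j.
have iX j : P.-integrable setT (EFin \o X j).
  by have [? ?] := mX' j; exact: integrable_of_sqr.
pose v j := if j == i then 0 else wstar j.
have vi0 : v i = 0 by rewrite /v eqxx.
have vE j : j != i -> v j = wstar j by rewrite /v => /negPf ->.
pose margin (w : 'I_d -> R) t :=
  1 - Y t * (\sum_(j < d) w j * X j t) + eps * \sum_(j < d) `|w j|.
pose b t := eps * `|wstar i| - Y t * (wstar i * X i t).
have marginE t : margin wstar t = margin v t + b t.
  rewrite /margin /b.
  (* [F] stands for the terms of the scalar product and of the l1 norm; [F 0 j = 0] makes the [i]-th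
     term for [v] drop out. *)
  have sumD (F : R -> 'I_d -> R) : (forall j, F 0 j = 0) ->
      \sum_(j < d) F (wstar j) j =
      F (wstar i) i + \sum_(j < d) F (v j) j.
    move=> F0; rewrite [LHS](bigD1 i)// [in RHS](bigD1 i)//= vi0 F0 add0r.
    by congr (_ + _); apply: eq_bigr => j ji; rewrite vE.
  rewrite (sumD (fun x j => x * X j t)); last by move=> j; rewrite mul0r.
  rewrite (sumD (fun x j => `|x|)); last by move=> j; rewrite normr0.
  ring.
have mm w : measurable_fun setT (margin w).
  apply: measurable_funD => //; apply: measurable_funB => //.
  apply: measurable_funM => //; apply: measurable_sum => j.
  exact: measurable_funM.
have iYX f : measurable_fun setT f -> P.-integrable setT (EFin \o f) ->
    P.-integrable setT (fun t => (Y t * f t)%:E).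
  move=> mf; apply: le_integrable => //.
    by apply/measurable_EFinP; exact: measurable_funM.
  by move=> t _ /=; rewrite lee_fin normrM; case: (Ypm1 t) => ->;
    rewrite ?normrN normr1 mul1r.
have icst (k : R) : P.-integrable setT (fun=> k%:E).
  exact: finite_measure_integrable_cst.
have iwX w : P.-integrable setT (fun t => (\sum_(j < d) w j * X j t)%:E).
  under eq_fun do rewrite -sumEFin.
  apply: integrable_sum => // j _.
  exact: (integrableZl measurableT (w j) (iX j)).
have im w : P.-integrable setT (EFin \o margin w).
  apply: (integrableD _ (integrableB _ (icst 1) (iYX _ _ (iwX w))) (icst _)) => //.
  by apply: measurable_sum => j; exact: measurable_funM.
have ih w : P.-integrable setT (fun t => (Num.max 0 (margin w t))%:E).
  apply: le_integrable (im w) => //.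
    by apply/measurable_EFinP; exact: measurable_maxr.
  move=> t _ /=; rewrite lee_fin.
  by case: (leP 0 (margin w t)) => ?; rewrite ?normr0.
have ib : P.-integrable setT (EFin \o b).
  apply: (integrableB _ (icst _) (iYX _ _ _)) => //.
    exact: measurable_funM.
  exact: (integrableZl measurableT (wstar i) (iX i)).
pose C := [set t | 0 < margin v t].
have mC : measurable C.
  have := mm v measurableT `]0, +oo[%classic (measurable_itv _).
  rewrite setTI; congr (measurable _).
  by apply/seteqP; split=> t /=; rewrite in_itv/= andbT.
have mYs s : measurable (Y @^-1` [set s]).
  by rewrite -[_ @^-1` _]setTI; exact: mY.
(* For a fixed label the margin of [v] no longer contains [Y], and [C] becomes a half-space in the
   features other than [i]. *)
have CE s : Y @^-1` [set s] `&` C = Y @^-1` [set s] `&`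
    [set t | 0 < 1 + eps * (\sum_(j < d) `|v j|) - s * \sum_(j < d) v j * X j t].
  by apply/seteqP; split=> t [/= Yt]; rewrite /C /= /margin Yt addrAC.
have b_ge0 : (0 <= \int[P]_(t in C) (b t)%:E)%E.
  have -> : C = (Y @^-1` [set 1] `&` C) `|` (Y @^-1` [set -1] `&` C).
    apply/seteqP; split=> t; last by move=> [] [].
    by move=> Ct; case: (Ypm1 t) => Yt; [left|right].
  have bs s : s = 1 \/ s = -1 ->
      (0 <= \int[P]_(t in Y @^-1` [set s] `&` C) (b t)%:E)%E.
    move=> s1; rewrite CE.
    rewrite (eq_integral (fun t =>
      (eps * `|wstar i| - s * (wstar i * X i t))%:E)); last first.
      by move=> t; rewrite inE => -[/= Yt _]; rewrite /b Yt.
    exact: (slar_nonrobust_integral_ge0 _ _ _ _ _ _ _ mu).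
  rewrite integral_setU//; [|exact: measurableI|exact: measurableI| |].
  - by rewrite adde_ge0// bs//; [left|right].
  - by apply: measurable_funTS; exact: measurable_int ib.
  - apply/disj_setPS => t [[/= -> _] [/= h _]].
    by have := ltr0N1 R; rewrite h; lra.
have hinge_le : (\int[P]_t (Num.max 0 (margin v t))%:E <=
                 \int[P]_t (Num.max 0 (margin wstar t))%:E)%E.
  have ibC : P.-integrable setT ((EFin \o b) \_ C).
    exact/(integrable_mkcond _ mC)/(integrableS measurableT mC (@subsetT _ _) ib).
  apply: (@le_trans _ _ (\int[P]_t ((Num.max 0 (margin v t))%:E +
                                    ((EFin \o b) \_ C) t)))%E.
    by rewrite integralD// -integral_mkcond leeDl.
  apply: le_integral => //; first exact: integrableD.
  (* On [C] the hinge of [wstar] is bounded below by its margin, off [C] by 0. *)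
  move=> t _; rewrite marginE patchE; case: ifPn; rewrite ?inE ?notin_setE /C /=.
  - by move=> h; rewrite -EFinD lee_fin (max_r (ltW h)) le_max lexx orbT.
  - move=> /negP; rewrite -leNgt => h.
    by rewrite adde0 lee_fin (max_l h) le_max lexx.
have sqE : \sum_(j < d) wstar j ^+ 2 = wstar i ^+ 2 + \sum_(j < d) v j ^+ 2.
  rewrite (bigD1 i)//= [in RHS](bigD1 i)//= vi0 expr0n add0r; congr (_ + _).
  by apply: eq_bigr => j ji; rewrite vE.
have := wmin v; rewrite /adv_obj -/(margin _ _).
(* Finiteness of the hinge terms turns minimality into an inequality between reals, where they can
   be moved across. *)
have finI w : (\int[P]_t (Num.max 0 (margin w t))%:E =
    (fine (\int[P]_t (Num.max 0 (margin w t))%:E))%:E)%E.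
  by rewrite fineK//; exact: integrable_fin_num.
move: hinge_le; rewrite (finI v) (finI wstar) -!EFinD !lee_fin sqE.
set x := fine _; set y := fine _ => xy h.
(* It suffices that [lam / 2 * wstar i ^ 2 <= 0], which is the difference of the regularizers once
   the hinge terms are compared. *)
apply/eqP; rewrite -sqrf_eq0 eq_le sqr_ge0 andbT.
rewrite -(pmulr_rle0 _ (divr_gt0 lam0 (ltr0Sn R 1))).
by move: h; rewrite mulrDr; lra.
Qed.
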